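(* Let $Q$ be a quiver, $\alpha\ge1$ and $\mathbf r=\underline1=(1)_{i\in Q_0}$. Then the polynomial $A_{(Q,\alpha),\mathbf r}$ has non-negative coefficients.
   Context: A quiver $Q=(Q_0,Q_1,s,t)$ has finite vertex set $Q_0$ and arrow set $Q_1$ (loops and multiple arrows allowed). For a prime power $q$ let $\mathcal O_\alpha=\mathbb F_q[t]/(t^\alpha)$. A locally free representation of $Q$ over $\mathcal O_\alpha$ of rank $\underline1$ is a tuple $x=(x_a)_{a\in Q_1}\in\mathcal O_\alpha^{Q_1}$ (free modules $\mathcal O_\alpha$ at each vertex, multiplication by $x_a$ along each arrow $a$); two are isomorphic iff related by the action $(g\cdot x)_a=g_{t(a)}x_ag_{s(a)}^{-1}$ of $(\mathcal O_\alpha^\times)^{Q_0}$. It is absolutely indecomposable if it is indecomposable after base change to $\overline{\mathbb F_q}[t]/(t^\alpha)$ (equivalently, the graph on $Q_0$ with edges $\{a:x_a\ne0\}$ is connected). $A_{(Q,\alpha),\underline1}(q)$ is the number of isomorphism classes of absolutely indecomposable locally free representations of rank $\underline1$ over $\mathcal O_\alpha$; it is known that this is the value at $q$ of a polynomial with integer coefficients independent of $q$, denoted $A_{(Q,\alpha),\underline1}$. *)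

(* Defs.v *)
From HB Require Import structures.
From mathcomp Require Import all_boot all_order all_algebra all_field.
From mathcomp Require Import boolp.

Set Implicit Arguments.
Unset Strict Implicit.
Unset Printing Implicit Defensive.

Import GRing.Theory.
Local Open Scope ring_scope.

Record quiver := Quiver {
  vertex : finType;
  arrow : finType;
  source : arrow -> vertex;
  target : arrow -> vertex }.

Record representation (Q : quiver) (R : comNzRingType) := Representation {
  rep_space : vertex Q -> lmodType R;
  rep_map : forall a : arrow Q,
    {linear rep_space (source a) -> rep_space (target a)} }.

Section Indecomposable.
Variables (Q : quiver) (R : comNzRingType) (M : representation Q R).

Definition subfamily := forall i : vertex Q, rep_space M i -> Prop.

Definition is_subrep (U : subfamily) : Prop :=
  [/\ forall i, U i 0,
      forall i (c : R) (u v : rep_space M i), U i u -> U i v -> U i (c *: u + v)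
    & forall a (u : rep_space M (source a)),
        U (source a) u -> U (target a) (rep_map M a u)].

Definition is_zero_subrep (U : subfamily) : Prop := forall i u, U i u -> u = 0.

Definition is_direct_sum (U W : subfamily) : Prop :=
  forall i,
    (forall v, exists u w, [/\ U i u, W i w & v = u + w]) /\
    (forall v, U i v -> W i v -> v = 0).

Definition indecomposable : Prop :=
  (exists i, exists v : rep_space M i, v <> 0) /\
  forall U W : subfamily, is_subrep U -> is_subrep W -> is_direct_sum U W ->
    is_zero_subrep U \/ is_zero_subrep W.

End Indecomposable.

Definition rank1_rep (Q : quiver) (R : comNzRingType) (x : arrow Q -> R) :
    representation Q R :=
  @Representation Q R (fun=> R^o)
    (fun a => x a \*: (idfun : {linear R^o -> R^o})).

(* R[t]/(t^alpha).  The library replaces a modulus of degree 0 by 'X, so this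
   is the intended ring only for alpha > 0. *)
Notation truncpoly R alpha := {poly %/ ('X^alpha : {poly R})}.

Definition alg_closure (F : finFieldType) : countClosedFieldType :=
  projT1 (countable_algebraic_closure F).

Definition to_alg_closure (F : finFieldType) : {rmorphism F -> alg_closure F} :=
  sval (projT2 (countable_algebraic_closure F)).

Section Counting.
Variables (Q : quiver) (alpha : nat) (F : finFieldType).

Notation O := (truncpoly F alpha).
Notation Obar := (truncpoly (alg_closure F) alpha).

Definition base_change (p : O) : Obar :=
  in_qpoly ('X^alpha) (map_poly (to_alg_closure F) p).

Definition abs_indecomposable (x : {ffun arrow Q -> O}) : Prop :=
  indecomposable (rank1_rep (fun a => base_change (x a))).

Definition rank1_iso (x y : {ffun arrow Q -> O}) : bool :=
  [exists g : {ffun vertex Q -> O},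
    [forall i, g i \is a GRing.unit] &&
    [forall a, y a == g (target a) * x a * (g (source a))^-1]].

Definition num_abs_indecomposable : nat :=
  #|equivalence_partition rank1_iso [set x | `[< abs_indecomposable x >]]|.

End Counting.

Definition is_counting_polynomial (Q : quiver) (alpha : nat) (A : {poly int}) : Prop :=
  forall F : finFieldType,
    A.[#|F|%:Z] = (num_abs_indecomposable Q alpha F)%:Z.

(* Main.v *)
(* Let R = F_q[t]/(t^alpha), let T be the torus of Q_0-tuples of units of R, and
   let the level of x_a be the least k with t^k x_a = 0, so that q^k elements
   have level at most k.  A rank
   one family is absolutely indecomposable iff the arrows with x_a <> 0 connect
   Q_0, and by Burnside the number of orbits times |T| is the number of pairs
   (g, x) with g in T fixing x and x connecting.  These pairs are counted in the
   manner of Kruskal's algorithm, always treating an undecided arrow e for which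
   the bound k on its level is maximal.
   - If the ends of e are already joined by chosen arrows, whose levels are all at
     least k, then g fixes x_e automatically, and e contributes a factor q^k.
   - Otherwise either x_e has level less than k, or it has level k and e is
     chosen; in the latter case the condition g_{t(e)} = g_{s(e)} mod t^k divides
     the size of the group of admissible g exactly by the number of such x_e.
   The count is therefore |T| times a sum of powers of q. *)
Require Import Defs.
From mathcomp Require Import all_boot all_order all_algebra all_field.
From mathcomp Require Import boolp.
From mathcomp Require Import zify.
Import GRing.Theory Num.Theory.
Local Open Scope ring_scope.

Set Implicit Arguments.
Unset Strict Implicit.
Unset Printing Implicit Defensive.

(** * Connectivity of the undirected graph spanned by a set of arrows *)

Section Connectivity.
Variable Q : quiver.
Implicit Types (S : pred (arrow Q)) (e a : arrow Q) (i j : vertex Q).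

Definition adjacent S : rel (vertex Q) := fun i j =>
  [exists a, S a && ((source a == i) && (target a == j)
                  || (source a == j) && (target a == i))].

(** The vertex set must be nonempty because the zero representation does not count as
    indecomposable. *)
Definition connecting S : bool :=
  (0 < #|vertex Q|)%N && [forall i, forall j, connect (adjacent S) i j].

Lemma adjacent_arrow S a : S a -> adjacent S (source a) (target a).
Proof. by move=> Sa; apply/existsP; exists a; rewrite Sa !eqxx. Qed.

Lemma adjacent_sym S : symmetric (adjacent S).
Proof. by move=> i j; apply: eq_existsb => a; rewrite orbC. Qed.

Lemma connect_adjacent_sym S : connect_sym (adjacent S).
Proof. by apply: sym_connect_sym; apply: adjacent_sym. Qed.

(** Connectivity is the least equivalence relation relating the ends of each arrow of [S]. Below,
    [r] is connectivity for another set of arrows, congruence of torus coordinates, or lying in the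
    same summand. *)
Lemma connect_adjacent_ind S (r : rel (vertex Q)) :
    equivalence_rel r -> (forall a, S a -> r (source a) (target a)) ->
  forall i j, connect (adjacent S) i j -> r i j.
Proof.
move=> er rS i j /connectP[p pth ->] {j}.
have rr k : r k k by case: (er k k k).
have tr x y z : r x y -> r y z -> r x z by case: (er x y z) => _ h /h ->.
have sy x y : r x y -> r y x by case: (er x y x) => _ h /h <-.
elim: p i pth => [|k p IHp] i //= /andP[/existsP[a /andP[Sa h]]] /IHp.
apply: tr; case/orP: h => /andP[/eqP<- /eqP<-]; first exact: rS.
exact/sy/rS.
Qed.

Lemma eq_connecting S S' : S =1 S' -> connecting S = connecting S'.
Proof.
move=> eS; rewrite /connecting; congr andb.
apply: eq_forallb => i; apply: eq_forallb => j; apply: eq_connect => k l.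
by apply: eq_existsb => a; rewrite eS.
Qed.

(** An arrow whose ends [S] already joins merges no components, whatever further arrows [T] are
    present. In the cycle case this makes connectivity insensitive to whether [x e] vanishes. *)
Lemma connecting_absorb S S' e :
    connect (adjacent S) (source e) (target e) ->
    subpred S S' -> (forall a, S' a -> S a \/ a = e) ->
  forall T : pred (arrow Q),
    connecting (fun a => S' a || T a) = connecting (fun a => S a || T a).
Proof.
move=> ce sub sub' T; rewrite /connecting; congr andb.
have mono (U U' : pred (arrow Q)) : subpred U U' ->
    subrel (connect (adjacent U)) (connect (adjacent U')).
  move=> sU; apply: connect_sub => k l /existsP[a /andP[/sU Ua h]].
  by apply/connect1/existsP; exists a; rewrite Ua.
apply: eq_forallb => i; apply: eq_forallb => j; apply/idP/idP.
  apply: connect_adjacent_ind.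
    by apply/equivalence_relP; split;
      [exact: connect0 | exact/same_connect/connect_adjacent_sym].
  move=> a /orP[/sub'[Sa|->]|Ta].
  - by apply/connect1/adjacent_arrow; rewrite /= Sa.
  - by apply: mono ce => b Sb; rewrite /= Sb.
  - by apply/connect1/adjacent_arrow; rewrite /= Ta orbT.
by apply: mono => a /orP[/sub|] h; rewrite /= h ?orbT.
Qed.

End Connectivity.

(** * Finite chain rings *)

Section ChainRing.

(** These are the properties of F_q[t]/(t^alpha) that the count relies on. Isolating them lets one
    polynomial be fixed before the ring and [q] are. *)
Record finite_chain_ring (R : finComUnitRingType) (t : R) (alpha q : nat) : Prop := {
  uniformizer_nilpotent : t ^+ alpha = 0;
  uniformizer_exponent : t ^+ alpha.-1 != 0;
  card_annihilator : forall k, (k <= alpha)%N ->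
    #|[set x : R | t ^+ k * x == 0]| = (q ^ k)%N;
  annihilator_gen : forall k x, (0 < k <= alpha)%N ->
    t ^+ k * x = 0 -> t ^+ k.-1 * x != 0 ->
    exists2 u, u \is a GRing.unit & x = u * t ^+ (alpha - k) }.

Variables (R : finComUnitRingType) (t : R) (alpha q : nat).
Hypothesis chainR : finite_chain_ring t alpha q.

Lemma annihilator_dvd k (x : R) : (k <= alpha)%N -> t ^+ k * x = 0 ->
  exists y, x = y * t ^+ (alpha - k).
Proof.
elim: k => [|k IHk] le_k; first by rewrite mul1r => ->; exists 0; rewrite mul0r.
move=> kx; have [kx0|kx0] := eqVneq (t ^+ k * x) 0.
  have [y ->] := IHk (ltnW le_k) kx0.
  by exists (y * t); rewrite -subSS subSn // exprS mulrA.
by have [u _ ->] := annihilator_gen chainR (k := k.+1) le_k kx kx0; exists u.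
Qed.

Lemma annihilator_uniformizer k : (0 < k <= alpha)%N ->
  (t ^+ k * t ^+ (alpha - k) = 0) * (t ^+ k.-1 * t ^+ (alpha - k) != 0).
Proof.
case/andP=> k0 kal; rewrite -!exprD; split.
  by rewrite subnKC // (uniformizer_nilpotent chainR).
have -> : (k.-1 + (alpha - k) = alpha.-1)%N by lia.
exact: uniformizer_exponent chainR.
Qed.

End ChainRing.

(** * The two steps of the recursion on stable pairs *)

Section Counting.
Variables (Q : quiver) (R : finComUnitRingType) (t : R) (alpha q : nat).
Hypothesis chainR : finite_chain_ring t alpha q.

Local Notation V := (vertex Q).
Local Notation E := (arrow Q).
Implicit Types (g : {ffun V -> R}) (x : {ffun E -> R}) (c m : E -> nat) (e a : E).

Definition torus : {set {ffun V -> R}} :=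
  [set g : {ffun V -> R} | [forall i, g i \is a GRing.unit]].

(** Multiplication by t^(alpha - c a) expresses congruence modulo t^(c a) without a quotient ring.
    For [c a = 0] the condition is void, as t^alpha = 0. *)
Definition congruence_torus c : {set {ffun V -> R}} :=
  [set g in torus |
    [forall a, (g (target a) - g (source a)) * t ^+ (alpha - c a) == 0]].

Definition stabilizes g x : bool :=
  [forall a, (g (target a) - g (source a)) * x a == 0].

(* A state of the count: [0 < c a] means that [a] has been chosen with level
   [c a], and [m a] bounds the level of [x_a] ([0] once [a] is decided). *)
Definition stable_pairs c m : {set {ffun V -> R} * {ffun E -> R}} :=
  [set p : {ffun V -> R} * {ffun E -> R} | [&& p.1 \in congruence_torus c,
               [forall a, t ^+ m a * p.2 a == 0],
               stabilizes p.1 p.2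
             & connecting [pred a | (p.2 a != 0) || (0 < c a)%N]]].

Definition update x e v : {ffun E -> R} := [ffun a => if a == e then v else x a].

(** The map (v, (g, x)) -> (g, [update x e v]) is a bijection from [D] x [B] onto [A], whose inverse
    reads off [x e] and resets it to 0. *)
Lemma card_update e (A B : {set {ffun V -> R} * {ffun E -> R}}) (D : {set R}) :
    (forall p, p \in B -> p.2 e = 0) ->
    (forall g x v, x e = 0 ->
       ((g, update x e v) \in A) = (v \in D) && ((g, x) \in B)) ->
  #|A| = (#|D| * #|B|)%N.
Proof.
move=> B0 AB.
pose f (p : R * ({ffun V -> R} * {ffun E -> R})) := (p.2.1, update p.2.2 e p.1).
rewrite -cardsX -(card_in_imset (f := f)); last first.
  move=> [v [g x]] [w [h y]] /setXP[/= _ /B0 /= x0] /setXP[/= _ /B0 /= y0].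
  rewrite /f /= => -[-> /ffunP xy].
  have -> : v = w by have := xy e; rewrite !ffunE eqxx.
  congr (_, (_, _)); apply/ffunP => a; have := xy a; rewrite !ffunE.
  by case: eqP => [->|//]; rewrite x0 y0.
congr #|pred_of_set _|; apply/setP => -[g x]; apply/idP/imsetP; last first.
  move=> [[v [h y]] /setXP[/= vD pB]]; rewrite /f /= => ->.
  by rewrite AB ?vD //; apply: B0 pB.
have x0 : update x e 0 e = 0 by rewrite ffunE eqxx.
have xe : x = update (update x e 0) e (x e).
  by apply/ffunP => a; rewrite !ffunE; case: eqP => [->|].
rewrite {1}xe AB // => /andP[vD pB].
by exists (x e, (g, update x e 0)); rewrite ?inE /= ?vD //; congr (_, _).
Qed.

Lemma forall_update x e v (P : E -> R -> bool) :
  [forall a, P a (update x e v a)] = P e v && [forall (a | a != e), P a (x a)].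
Proof.
apply/forallP/andP => [h|[hv /forall_inP h] a].
  split; first by have := h e; rewrite ffunE eqxx.
  by apply/forall_inP => a /negPf ne; have := h a; rewrite ffunE ne.
by rewrite ffunE; case: eqVneq => [->|/h].
Qed.

(** The intended range is k > 0; for k = 0 the two conditions contradict each other and the set is
    empty. *)
Definition exact_level k : {set R} :=
  [set v : R | (t ^+ k * v == 0) && (t ^+ k.-1 * v != 0)].

Lemma congruence_torus_unit c g i : g \in congruence_torus c -> g i \is a GRing.unit.
Proof. by rewrite !inE => /andP[/forallP]. Qed.

Lemma congruence_torus_set_level c e k g : c e = 0%N ->
  (g \in congruence_torus [eta c with e |-> k]) =
  (g \in congruence_torus c) &&
  ((g (target e) - g (source e)) * t ^+ (alpha - k) == 0).
Proof.
move=> ce; rewrite !inE -andbA; congr andb; apply/forallP/andP.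
  move=> h; split; last by have := h e; rewrite /= eqxx.
  apply/forallP => a; have := h a; rewrite /=; case: (eqVneq a e) => // -> _.
  by rewrite ce subn0 (uniformizer_nilpotent chainR) mulr0.
by move=> [/forallP h he] a /=; case: (eqVneq a e) => [->|].
Qed.

(** The conditions at [e] are separated from those at the other arrows, so that two states differing
    only at [e] can be compared conjunct by conjunct. *)
Lemma stable_pairs_update c m g x e v :
  ((g, update x e v) \in stable_pairs c m) =
  [&& t ^+ m e * v == 0, (g (target e) - g (source e)) * v == 0,
      g \in congruence_torus c, [forall (a | a != e), t ^+ m a * x a == 0],
      [forall (a | a != e), (g (target a) - g (source a)) * x a == 0] &
      connecting [pred a | (if a == e then v != 0 else x a != 0) || (0 < c a)%N]].
Proof.
rewrite inE /= /stabilizes.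
rewrite (forall_update x e v (fun a y => t ^+ m a * y == 0)).
rewrite (forall_update x e v (fun a y => (g (target a) - g (source a)) * y == 0)).
rewrite (eq_connecting (S' := [pred a | (if a == e then v != 0 else x a != 0)
  || (0 < c a)%N])); last by move=> a; rewrite /= ffunE; case: (a == e).
by rewrite -!andbA; do 5!bool_congr.
Qed.

Lemma stable_pairs_at0 c m g x e : x e = 0 ->
  ((g, x) \in stable_pairs c m) =
  [&& g \in congruence_torus c, [forall (a | a != e), t ^+ m a * x a == 0],
      [forall (a | a != e), (g (target a) - g (source a)) * x a == 0] &
      connecting [pred a | (x a != 0) || (0 < c a)%N]].
Proof.
move=> x0; have xE : x = update x e 0.
  by apply/ffunP => a; rewrite ffunE; case: eqP => [->|].
rewrite {1}xE stable_pairs_update !mulr0 eqxx /=; do 3!congr andb.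
by apply: eq_connecting => a /=; case: (eqVneq a e) => [->|//]; rewrite x0 eqxx.
Qed.

Lemma forall_neq_set_level (m : E -> nat) e k x :
  [forall (a | a != e), t ^+ [eta m with e |-> k] a * x a == 0] =
  [forall (a | a != e), t ^+ m a * x a == 0].
Proof. by apply: eq_forallb => a /=; case: (eqVneq a e). Qed.

Lemma stable_pairs_level0 c m e p :
  p \in stable_pairs c [eta m with e |-> 0%N] -> p.2 e = 0.
Proof.
by rewrite inE => /and4P[_ /forallP/(_ e) + _ _]; rewrite /= eqxx mul1r => /eqP.
Qed.

(* Within the classes of {0 < c} all congruences hold modulo t ^ (m e), so the
   constraint on x_e is automatic. *)
Lemma card_stable_pairs_cycle c m e :
    (m e <= alpha)%N -> (forall a, (0 < c a)%N -> (m e <= c a)%N) ->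
    connect (adjacent [pred a | (0 < c a)%N]) (source e) (target e) ->
  #|stable_pairs c m| = (q ^ m e * #|stable_pairs c [eta m with e |-> 0%N]|)%N.
Proof.
move=> le_m cm ce; rewrite -(card_annihilator chainR le_m).
apply: (@card_update e) => [p|g x v x0]; first exact: stable_pairs_level0.
rewrite stable_pairs_update (stable_pairs_at0 _ _ _ x0) [v \in _]inE forall_neq_set_level.
have [mv|//] := eqVneq (t ^+ m e * v) 0.
rewrite !andTb; have [gc|_] := boolP (g \in congruence_torus c); last by rewrite /= andbF.
have -> : (g (target e) - g (source e)) * v == 0.
  have [y ->] := annihilator_dvd chainR le_m mv.
  suff: (g (source e)) * t ^+ (alpha - m e) == g (target e) * t ^+ (alpha - m e).
    by move=> /eqP h; rewrite mulrCA mulrBl h subrr mulr0.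
  move: ce; apply: (@connect_adjacent_ind _ _
    (fun i j => g i * t ^+ (alpha - m e) == g j * t ^+ (alpha - m e))).
    by move=> i j k; split=> // /eqP->.
  move=> a /= ca; move: gc; rewrite inE => /andP[_ /forallP/(_ a)/eqP gca].
  rewrite eq_sym -subr_eq0 -mulrBl.
  (* Since [m e <= c a], the congruence at [a] modulo t^(c a) implies the one modulo t^(m e). *)
  have /subnK <- : (alpha - c a <= alpha - m e)%N by apply/leq_sub2l/cm.
  by rewrite exprD mulrCA gca mulr0.
rewrite /=; do 2!congr (_ && _).
have absorb := @connecting_absorb Q [pred a | (0 < c a)%N]
  [pred a | (0 < c a)%N || (a == e) && (v != 0)] e ce _ _ (fun a => x a != 0).
transitivity (connecting (fun a => ((0 < c a)%N || (a == e) && (v != 0)) || (x a != 0))).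
  apply: eq_connecting => a /=.
  case: (eqVneq a e) => [->|_] /=; last by rewrite orbF orbC.
  by rewrite x0 eqxx orbF orbC.
rewrite absorb; first by apply: eq_connecting => a /=; rewrite orbC.
  by move=> a /= ->.
by move=> a /= /orP[|/andP[/eqP]]; [left | right].
Qed.

(** Pairs are split by whether [x e] has level below [m e] or exactly [m e]. In the second case
    [x e] is a unit times t^(alpha - m e), so fixing it amounts to the congruence modulo t^(m e)
    that choosing [e] adds to the torus. *)
Lemma card_stable_pairs_bridge c m e :
    (0 < m e <= alpha)%N -> c e = 0%N ->
  #|stable_pairs c m| =
  (#|stable_pairs c [eta m with e |-> (m e).-1]| +
   #|exact_level (m e)| *
   #|stable_pairs [eta c with e |-> m e] [eta m with e |-> 0%N]|)%N.
Proof.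
move=> le_m ce; have [m_gt0 m_le] := andP le_m.
set A := stable_pairs c m; set A' := stable_pairs c _.
have sA : A' \subset A.
  apply/subsetP => p; rewrite !inE => /and4P[-> /forallP h -> ->]; rewrite !andbT /=.
  apply/forallP => a; have := h a; rewrite /=; case: (eqVneq a e) => [->|//] /eqP h'.
  by rewrite -(prednK m_gt0) exprS -mulrA h' mulr0.
rewrite -(cardsID A' A) (setIidPr sA); congr addn.
apply: (@card_update e) => [p|g x v x0]; first exact: stable_pairs_level0.
rewrite in_setD !stable_pairs_update (stable_pairs_at0 _ _ _ x0) [v \in _]inE.
rewrite !forall_neq_set_level /= eqxx congruence_torus_set_level //.
have [mv|] := eqVneq (t ^+ m e * v) 0; last by rewrite andbF.
have [mv'|mv'] := eqVneq (t ^+ (m e).-1 * v) 0; first by rewrite /= andNb.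
have [u u_unit vE] := annihilator_gen chainR le_m mv mv'.
have v0 : v != 0 by apply: contraNneq mv' => ->; rewrite mulr0.
rewrite /= [in X in X && _]vE mulrCA (mulrI_eq0 _ (mulrI u_unit)).
rewrite -andbA; bool_congr; do 3!congr (_ && _).
apply: eq_connecting => a /=; case: (eqVneq a e) => [->|//].
by rewrite v0 m_gt0 orbT.
Qed.

(** The fibres of [f] over [exact_level k] all have the same size: each is a translate of the
    subgroup cut out by the additional congruence at [e]. *)
Lemma card_congruence_torus_bridge c e k :
    (0 < k <= alpha)%N -> c e = 0%N ->
    ~~ connect (adjacent [pred a | (0 < c a)%N]) (source e) (target e) ->
  (#|exact_level k| *
   #|congruence_torus [eta c with e |-> k]|)%N = #|congruence_torus c|.
Proof.
move=> le_k ce nce; pose f g := g (target e) / g (source e) * t ^+ (alpha - k).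
have fD : {in congruence_torus c, forall g, f g \in exact_level k}.
  move=> g gc; rewrite inE /f mulrCA [t ^+ k.-1 * _]mulrCA.
  rewrite (annihilator_uniformizer chainR le_k) mulr0 eqxx /=.
  rewrite mulrI_eq0; first by rewrite (annihilator_uniformizer chainR le_k).
  by apply: mulrI; rewrite unitrM unitrV !(congruence_torus_unit _ gc).
rewrite -[RHS]sum1_card (partition_big f (mem (exact_level k))) //= -sum_nat_const.
apply: eq_bigr => v; rewrite inE => /andP[/eqP kv kv'].
have [u u_unit ->] := annihilator_gen chainR le_k kv kv'.
(* Being constant on the components of the chosen arrows, [h] preserves the old congruences. As [e]
   joins two different components, multiplication by [h] changes the ratio of the coordinates at the
   ends of [e] by exactly [u]. *)
pose h : {ffun V -> R} := [ffun i =>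
  if connect (adjacent [pred a | (0 < c a)%N]) (target e) i then u else 1].
have h_unit i : h i \is a GRing.unit by rewrite ffunE; case: ifP; rewrite ?unitr1.
pose shift g : {ffun V -> R} := [ffun i => h i * g i].
have shift_inj : injective shift.
  move=> g g' /ffunP eg; apply/ffunP => i; have := eg i; rewrite !ffunE.
  by apply: mulrI; have := h_unit i; rewrite ffunE.
have shift_congruence g : (shift g \in congruence_torus c) = (g \in congruence_torus c).
  rewrite !inE; congr andb.
    by apply: eq_forallb => i; rewrite ffunE unitrM h_unit.
  apply: eq_forallb => a; case: (posnP (c a)) => [->|ca].
    by rewrite subn0 (uniformizer_nilpotent chainR) !mulr0.
  have hE : h (source a) = h (target a).
    rewrite !ffunE; congr (if _ then _ else _).
    apply: same_connect_r; first exact: connect_adjacent_sym.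
    exact/connect1/adjacent_arrow.
  rewrite ![shift _ _]ffunE hE -mulrBr -mulrA.
  by rewrite (mulrI_eq0 _ (mulrI (h_unit _))).
rewrite sum1dep_card -[LHS](card_imset _ shift_inj); apply: eq_card => g.
have [g' ->] : exists g', g = shift g'.
  exists [ffun i => (h i)^-1 * g i]; apply/ffunP => i.
  by rewrite ![in RHS]ffunE; have := h_unit i; rewrite ffunE => /mulVKr->.
rewrite mem_imset // [RHS]inE congruence_torus_set_level // shift_congruence.
have [gc|//] := boolP (_ \in _).
rewrite /= /f ![shift _ _]ffunE [h (target e)]ffunE [h (source e)]ffunE connect0.
rewrite connect_adjacent_sym (negPf nce) mul1r -!mulrA (inj_eq (mulrI u_unit)).
have gu := congruence_torus_unit (source e) gc.
by rewrite mulrBl subr_eq0 -[RHS](inj_eq (mulrI gu)) mulrCA mulVKr.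
Qed.

End Counting.

(** * The recursion and its polynomial *)

Lemma sum_set_level (I : finType) (m : I -> nat) e v : (v < m e)%N ->
  (\sum_i [eta m with e |-> v] i < \sum_i m i)%N.
Proof.
move=> lt_v; rewrite (bigD1 e) // [ltnRHS](bigD1 e) //= eqxx -addSn.
by apply: leq_add => //; rewrite leq_eqVlt; apply/orP; left; apply/eqP;
  apply: eq_bigr => i /negPf->.
Qed.

(** Induction on the sum of the bounds [m]. The branching depends only on [c] and [m], so [P] is
    uniform in the ring. The second hypothesis is the Kruskal invariant: chosen levels dominate all
    remaining bounds. *)
Lemma stable_pairs_polynomial (Q : quiver) (alpha : nat) (c m : arrow Q -> nat) :
    (forall e, (m e <= alpha)%N) ->
    (forall a e, (0 < c a)%N -> (m e <= c a)%N) ->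
  exists P : {poly int}, (forall i, 0 <= P`_i) /\
    forall (R : finComUnitRingType) (t : R) q, finite_chain_ring t alpha q ->
      #|stable_pairs t alpha c m|%:Z = #|congruence_torus t alpha c|%:Z * P.[q%:Z].
Proof.
have [n] := ubnP (\sum_e m e); elim: n c m => // n IHn c m lt_n m_le cm.
case: (pickP (fun e => 0 < m e)%N) => [e0 m0|m0]; last first.
  (* All bounds are 0, which forces x = 0; connectivity is then decided by [c] alone. *)
  exists (connecting [pred a | (0 < c a)%N])%:R; split.
    by move=> i; case: connecting; rewrite ?coef0 // coef1; case: eqP.
  move=> R t q chainR.
  have pairE g x : ((g, x) \in stable_pairs t alpha c m) =
      [&& g \in congruence_torus t alpha c, x == 0 & connecting [pred a | (0 < c a)%N]].
    rewrite inE /=; congr andb; have me a : m a = 0%N by have := m0 a; lia.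
    have -> : [forall a, t ^+ m a * x a == 0] = (x == 0).
      apply/forallP/eqP => [h|-> a]; last by rewrite ffunE mulr0.
      by apply/ffunP => a; have := h a; rewrite me mul1r ffunE => /eqP.
    have [->|//] := eqVneq x 0; rewrite /=.
    have -> : stabilizes g (0 : {ffun arrow Q -> R}).
      by apply/forallP => a; rewrite ffunE mulr0.
    by apply: eq_connecting => a /=; rewrite ffunE eqxx.
  case: connecting pairE => pairE; last first.
    rewrite horner0 mulr0 eq_card0 // => -[g x].
    by rewrite pairE !andbF.
  rewrite hornerC mulr1; congr Posz.
  have /card_imset <- : injective (fun g : {ffun vertex Q -> R} =>
    (g, 0 : {ffun arrow Q -> R})) by move=> g h [].
  apply: eq_card => -[g x]; rewrite pairE andbT.
  apply/andP/imsetP => [[gc /eqP->]|[h hc [-> ->]]]; first by exists g.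
  by rewrite eqxx.
have [e _ max_e] := @arg_maxnP _ e0 predT m isT.
have me : (0 < m e)%N by apply: leq_trans m0 (max_e e0 isT).
have me_le : (0 < m e <= alpha)%N by rewrite me m_le.
have upd_le v : (v <= m e)%N -> forall a, ([eta m with e |-> v] a <= m a)%N.
  by move=> ? a /=; case: (eqVneq a e) => [->|].
have [ce|nce] := boolP (connect (adjacent [pred a | (0 < c a)%N]) (source e) (target e)).
  have [|a|a b ca|P [P0 PE]] := IHn c [eta m with e |-> 0%N].
  - exact: leq_trans (sum_set_level me) lt_n.
  - by apply: leq_trans (upd_le _ _ _) (m_le a).
  - by apply: leq_trans (upd_le _ _ _) (cm _ b ca).
  exists ('X^(m e) * P); split=> [i|R t q chainR].
    by rewrite coefXnM; case: ifP.
  rewrite (card_stable_pairs_cycle chainR (m_le e)) // => [|a]; last exact: cm.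
  by rewrite PoszM (PE _ _ _ chainR) hornerM hornerXn mulrCA -!natz natrX.
have c0 : c e = 0%N.
  by apply: contraNeq nce; rewrite -lt0n => ce; apply/connect1/adjacent_arrow.
have [|a|a b ca|P [P0 PE]] := IHn c [eta m with e |-> (m e).-1].
- by apply: leq_trans (sum_set_level _) lt_n; rewrite prednK.
- by apply: leq_trans (upd_le _ _ _) (m_le a); rewrite leq_pred.
- by apply: leq_trans (upd_le _ _ _) (cm _ b ca); rewrite leq_pred.
have [|a|a b|P' [P'0 P'E]] := IHn [eta c with e |-> m e] [eta m with e |-> 0%N].
- exact: leq_trans (sum_set_level me) lt_n.
- by apply: leq_trans (upd_le _ _ _) (m_le a).
(* For the newly chosen arrow [e] the invariant is the maximality of [m e]. *)
- move=> ca; apply: leq_trans (upd_le _ _ _) _ => //; move: ca => /=.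
  by case: (eqVneq a e) => [_ _|_ /cm //]; apply: max_e.
exists (P + P'); split=> [i|R t q chainR]; first by rewrite coefD addr_ge0.
(* The number of values of [x e] of exact level [m e] is absorbed by the passage from the smaller
   torus back to that of [c], so [P'] enters with coefficient 1. *)
rewrite (card_stable_pairs_bridge chainR me_le c0) PoszD PoszM.
rewrite (PE _ _ _ chainR) (P'E _ _ _ chainR) hornerD mulrDr mulrA -PoszM.
by rewrite (card_congruence_torus_bridge chainR me_le c0 nce).
Qed.

(** * Burnside counting for the torus action *)

Section Orbits.
Variables (Q : quiver) (R : finComUnitRingType).
Implicit Types (g h : {ffun vertex Q -> R}) (x y : {ffun arrow Q -> R}).

Definition act g x : {ffun arrow Q -> R} :=
  [ffun a => g (target a) * x a * (g (source a))^-1].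

Lemma torus_unit g i : g \in torus Q R -> g i \is a GRing.unit.
Proof. by rewrite inE => /forallP. Qed.

Definition torus_orbit x y : bool := [exists g in torus Q R, y == act g x].

Lemma torusM g h : g \in torus Q R ->
  ([ffun i => g i * h i] \in torus Q R) = (h \in torus Q R).
Proof.
move=> gT; rewrite !inE; apply: eq_forallb => i.
by rewrite ffunE unitrM (torus_unit i gT).
Qed.

Lemma actM g h x : g \in torus Q R -> h \in torus Q R ->
  act [ffun i => g i * h i] x = act g (act h x).
Proof.
move=> gT hT; apply/ffunP => a; rewrite !ffunE invrM ?torus_unit // !mulrA.
by rewrite [g _ * h _ * _ * _]mulrAC.
Qed.

Lemma torus_orbit_equiv : equivalence_rel torus_orbit.
Proof.
have refl x : torus_orbit x x.
  apply/exists_inP; exists [ffun=> 1].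
    by rewrite inE; apply/forallP => i; rewrite ffunE unitr1.
  by apply/eqP/ffunP => a; rewrite !ffunE mul1r divr1.
have trans x y z : torus_orbit x y -> torus_orbit y z -> torus_orbit x z.
  move=> /exists_inP[g gT /eqP->] /exists_inP[h hT /eqP->].
  by apply/exists_inP; exists [ffun i => h i * g i]; rewrite ?torusM // actM.
have sym x y : torus_orbit x y -> torus_orbit y x.
  move=> /exists_inP[g gT /eqP->].
  have gT' : [ffun i => (g i)^-1] \in torus Q R.
    by rewrite inE; apply/forallP => i; rewrite ffunE unitrV torus_unit.
  apply/exists_inP; exists [ffun i => (g i)^-1] => //; rewrite -actM //.
  apply/eqP/ffunP => a; rewrite !ffunE !mulVr ?torus_unit // mul1r.
  by rewrite divr1.
move=> x y z; split=> // xy; apply/idP/idP; last exact: trans xy.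
exact/trans/sym.
Qed.

Lemma act_eq0 g x a : g \in torus Q R -> (act g x a == 0) = (x a == 0).
Proof.
move=> gT; rewrite ffunE -mulrA (mulrI_eq0 _ (mulrI (torus_unit _ gT))).
by rewrite mulrC mulrI_eq0 //; apply: mulrI; rewrite unitrV torus_unit.
Qed.

Definition stabilizer x : {set {ffun vertex Q -> R}} :=
  [set g in torus Q R | stabilizes g x].

Lemma stabilizes_fix g x : g \in torus Q R -> stabilizes g x = (act g x == x).
Proof.
move=> gT; apply/forallP/eqP => [gx|/ffunP gx a].
  apply/ffunP => a; rewrite [act _ _ _]ffunE.
  have := gx a; rewrite mulrBl subr_eq0 => /eqP->.
  by rewrite mulrAC mulrV ?torus_unit // mul1r.
have := gx a; rewrite ffunE => /(canRL (divrK (torus_unit _ gT))) gxa.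
by rewrite mulrBl gxa mulrC subrr.
Qed.

(** Writing g = h k and using commutativity, g sends x to [act h x] exactly when k fixes
    [act h x]. *)
Lemma card_transporter h x : h \in torus Q R ->
  #|[set g in torus Q R | act g x == act h x]| = #|stabilizer (act h x)|.
Proof.
move=> hT.
pose f (k : {ffun vertex Q -> R}) : {ffun vertex Q -> R} :=
  [ffun i => h i * k i].
have f_inj : injective f.
  move=> k k' /ffunP kk'; apply/ffunP => i; have := kk' i; rewrite !ffunE.
  exact/mulrI/torus_unit.
rewrite -[RHS](card_imset _ f_inj); apply: eq_card => g.
have [k ->] : exists k, g = f k.
  exists [ffun i => (h i)^-1 * g i]; apply/ffunP => i.
  by rewrite !ffunE mulVKr ?torus_unit.
rewrite mem_imset // [LHS]in_set [RHS]in_set [f k \in _]torusM //.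
have [kT|//] := boolP (_ \in _); rewrite /= stabilizes_fix //.
have -> : f k = [ffun i => k i * h i] by apply/ffunP => i; rewrite !ffunE mulrC.
by rewrite actM.
Qed.

Definition connecting_families : {set {ffun arrow Q -> R}} :=
  [set x : {ffun arrow Q -> R} | connecting [pred a | x a != 0]].

(** On the orbit of x, sorting the torus by the value [act g x] gives one fibre for each y, of size
    [#|stabilizer y|]. Hence the stabilizer sizes over each orbit add up to the order of the
    torus. *)
Lemma card_orbits_stabilizers :
  (#|equivalence_partition torus_orbit connecting_families| * #|torus Q R|)%N =
  (\sum_(x in connecting_families) #|stabilizer x|)%N.
Proof.
have eqR : {in connecting_families & &, equivalence_rel torus_orbit}.
  by move=> x y z _ _ _; apply: torus_orbit_equiv.
rewrite (set_partition_big _ (equivalence_partitionP eqR)) -sum_nat_const.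
apply: eq_bigr => _ /imsetP[x xX ->].
rewrite -sum1_card (partition_big (act^~ x)
  (mem [set y in connecting_families | torus_orbit x y])) /= => [|g gT].
  apply: eq_bigr => y; rewrite inE => /andP[_ /exists_inP[h hT /eqP->]].
  by rewrite sum1dep_card card_transporter.
rewrite !in_set; apply/andP; split; last by apply/exists_inP; exists g.
rewrite inE in xX; rewrite (eq_connecting (S' := [pred a | x a != 0])) // => a.
by rewrite /= act_eq0.
Qed.

Variables (t : R) (alpha : nat).
Hypothesis t_nilp : t ^+ alpha = 0.

Lemma congruence_torus0 : congruence_torus (Q := Q) t alpha (fun=> 0%N) = torus Q R.
Proof.
apply/setP => g; rewrite in_set andbC; case: forallP => // -[] a.
by rewrite subn0 t_nilp mulr0.
Qed.

(** With no arrow chosen and all bounds equal to [alpha], the state imposes no restriction beyond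
    stability and connectivity, because t^alpha = 0. *)
Lemma card_stable_pairs_stabilizers :
  #|stable_pairs (Q := Q) t alpha (fun=> 0%N) (fun=> alpha)| =
  (\sum_(x in connecting_families) #|stabilizer x|)%N.
Proof.
have pairE g x : ((g, x) \in stable_pairs t alpha (fun=> 0%N) (fun=> alpha)) =
    (x \in connecting_families) && (g \in stabilizer x).
  rewrite in_set /= congruence_torus0 !in_set.
  have -> : [forall a, t ^+ alpha * x a == 0].
    by apply/forallP => a; rewrite t_nilp mul0r.
  rewrite /= andbA andbC; congr andb.
  by apply: eq_connecting => a /=; rewrite orbF.
rewrite -sum1_card (partition_big snd (mem connecting_families)) /=.
  apply: eq_bigr => x xX; rewrite sum1dep_card.
  have /card_imset <- : injective (fun g => (g, x)) by move=> g h [].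
  apply: eq_card => -[g y]; rewrite inE pairE /=.
  apply/andP/imsetP => [[/andP[_ gy] /eqP <-]|[h hx [-> ->]]]; first by exists g.
  by rewrite xX hx.
by move=> [g x]; rewrite pairE => /andP[].
Qed.

End Orbits.

(** * Indecomposability in rank one as connectivity *)

Section Indecomposability.
Variables (Q : quiver) (R : comNzRingType) (x : arrow Q -> R).
Hypothesis idem : forall u : R, u * u = u -> u = 0 \/ u = 1.

(** A component and its complement support complementary subrepresentations. Conversely, the absence
    of nontrivial idempotents puts each vertex module wholly in one summand, and an arrow with
    [x a != 0] cannot lead from one summand to the other. *)
Lemma indecomposable_rank1 :
  indecomposable (rank1_rep x) <-> connecting [pred a | x a != 0].
Proof.
pose S : pred (arrow Q) := [pred a | x a != 0].
split=> [[[i0 _] indec]|/andP[/card_gt0P[i0 _] /forallP conn]].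
  apply/andP; split; first by apply/card_gt0P; exists i0.
  apply/forallP => i; apply/forallP => j; apply: contraT => nij.
  pose U : subfamily (rank1_rep x) := fun k u => ~~ connect (adjacent S) i k -> u = 0.
  pose W : subfamily (rank1_rep x) := fun k u => connect (adjacent S) i k -> u = 0.
  have xa a : x a != 0 ->
      connect (adjacent S) i (target a) = connect (adjacent S) i (source a).
    move=> xa; apply: same_connect_r; first exact: connect_adjacent_sym.
    by rewrite connect_adjacent_sym; apply/connect1/adjacent_arrow.
  have subU : is_subrep U.
    split=> [k //|k b u v Uu Uv h|a u Uu]; first by rewrite Uu // Uv // scaler0 addr0.
    rewrite /U /=; have [->|/xa ->] := eqVneq (x a) 0; first by rewrite scale0r.
    by move=> /Uu->; rewrite scaler0.
  have subW : is_subrep W.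
    split=> [k //|k b u v Wu Wv h|a u Wu]; first by rewrite Wu // Wv // scaler0 addr0.
    rewrite /W /=; have [->|/xa ->] := eqVneq (x a) 0; first by rewrite scale0r.
    by move=> /Wu->; rewrite scaler0.
  have [k|/(_ i 1)|/(_ j 1)] := indec U W subU subW.
  - rewrite /U /W; case: (connect (adjacent S) i k); split=> [v|v Uv Wv].
    + by exists v, 0; rewrite addr0.
    + exact: Wv.
    + by exists 0, v; rewrite add0r.
    + exact: Uv.
  - rewrite /U connect0 => h; have /eqP : (1 : R) = 0 by apply: h.
    by rewrite oner_eq0.
  - rewrite /W (negPf nij) => h; have /eqP : (1 : R) = 0 by apply: h.
    by rewrite oner_eq0.
split; first by exists i0, (1 : R^o); apply/eqP/oner_neq0.
move=> U W [U0 UD Ux] [W0 WD Wx] UW.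
have scaleU (i : vertex Q) (b u : R^o) : U i u -> U i (b *: u).
  by move=> Uu; rewrite -[_ *: _]addr0; apply: UD.
have scaleW (i : vertex Q) (b u : R^o) : W i u -> W i (b *: u).
  by move=> Wu; rewrite -[_ *: _]addr0; apply: WD.
(* Decompose 1 = u + w. The product u w lies in both summands, so it vanishes and u = u (u + w) = u
   u is idempotent. *)
have UW1 i : U i (1 : R^o) \/ W i (1 : R^o).
  have [/(_ 1)[u [w [Uu Ww e1]]] UW0] := UW i.
  have uw0 : (u : R) * w = 0.
    apply: UW0; last exact: scaleW.
    by rewrite mulrC; apply: scaleU.
  have /idem[u0|u1] : (u : R) * u = u.
  - by rewrite -[RHS](mulr1 (u : R)) [in RHS]e1 mulrDr uw0 addr0.
  - by right; rewrite e1 u0 add0r.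
  - by left; rewrite -u1.
have disjoint i (b : R^o) : U i 1 -> W i 1 -> b = 0.
  move=> Ui Wi; apply: (UW i).2; rewrite -[b]mulr1.
    exact: scaleU.
  exact: scaleW.
have U1 a : S a -> `[< U (source a) (1 : R^o) >] == `[< U (target a) (1 : R^o) >].
  move=> /eqP xa; apply/eqP/asbool_equiv_eq; split=> [/Ux|Ut].
    case: (UW1 (target a)) => // Wt Uxa; case: xa.
    apply: (UW (target a)).2; first by rewrite -[x a]mulr1.
    by rewrite -[x a]mulr1; apply: scaleW.
  case: (UW1 (source a)) => // /Wx Wxa; case: xa.
  apply: (UW (target a)).2; last by rewrite -[x a]mulr1.
  by rewrite -[x a]mulr1; apply: scaleU.
have allU i : `[< U i0 (1 : R^o) >] == `[< U i (1 : R^o) >].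
  have /forallP/(_ i) := conn i0; apply: (@connect_adjacent_ind _ S
    (fun j k => `[< U j (1 : R^o) >] == `[< U k (1 : R^o) >]) _ U1).
  by move=> j k l; split=> // /eqP->.
have [Ui0|nUi0] := pselect (U i0 (1 : R^o)); [right | left] => i u hu.
  apply: (UW i).2 => //; rewrite -[u]mulr1; apply: scaleU.
  by apply/asboolP; rewrite -(eqP (allU i)); apply/asboolP.
apply: (UW i).2 => //; rewrite -[u]mulr1; apply: scaleW.
case: (UW1 i) => // Ui; case: nUi0.
by apply/asboolP; rewrite (eqP (allU i)); apply/asboolP.
Qed.

End Indecomposability.

(** * Truncated polynomial rings *)

Section TruncatedPolynomials.
Variables (K : fieldType) (alpha : nat).
Hypothesis alpha_gt0 : (0 < alpha)%N.
Local Notation O := (truncpoly K alpha).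
Local Notation pi := (in_qpoly ('X^alpha : {poly K})).

Lemma mk_monic_truncpoly : mk_monic ('X^alpha : {poly K}) = 'X^alpha.
Proof. by rewrite mk_monic_Xn prednK. Qed.

Lemma truncpolyK (x : O) : pi (x : {poly K}) = x.
Proof. by apply: val_inj; apply: in_qpoly_small; apply: size_mk_monic. Qed.

Lemma truncpoly_eq0 (p : {poly K}) : (pi p == 0) = ('X^alpha %| p).
Proof.
rewrite -val_eqE /= mk_monic_truncpoly.
by rewrite /dvdp Pdiv.IdomainMonic.modpE ?monicXn.
Qed.

Lemma coprimep_Xn_root (p : {poly K}) : ~~ root p 0 -> coprimep 'X^alpha p.
Proof.
move=> p0; apply: coprimep_expl.
by rewrite coprimep_sym -['X]subr0 -polyC0 coprimep_XsubC.
Qed.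

Lemma truncpoly_unit (p : {poly K}) : ~~ root p 0 -> pi p \is a GRing.unit.
Proof.
move=> /coprimep_Xn_root/Bezout_eq1_coprimepP[[u v] /= uv].
have vp : pi v * pi p = 1.
  apply/eqP; rewrite -subr_eq0 -rmorphM -[1](rmorph1 pi) -rmorphB truncpoly_eq0 -uv.
  by rewrite opprD addrCA subrr addr0 dvdpNr dvdp_mulIr.
by apply/unitrP; exists (pi v); split; rewrite // mulrC.
Qed.

(** X^alpha divides p (p - 1). The two factors cannot both vanish at 0, so X^alpha is coprime to one
    and divides the other. *)
Lemma truncpoly_idempotent (u : O) : u * u = u -> u = 0 \/ u = 1.
Proof.
rewrite -(truncpolyK u); set p : {poly K} := u.
move=> /eqP; rewrite -rmorphM -subr_eq0 -rmorphB /= truncpoly_eq0.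
have -> : p * p - p = p * (p - 1) by rewrite mulrBr mulr1.
have [p0|/coprimep_Xn_root p0] := boolP (root p 0).
  rewrite Gauss_dvdpl -?truncpoly_eq0 => [/eqP|]; first by left.
  apply: coprimep_Xn_root; move: p0; rewrite /root hornerD hornerN hornerC => /eqP->.
  by rewrite sub0r oppr_eq0 oner_eq0.
by rewrite Gauss_dvdpr // -truncpoly_eq0 rmorphB rmorph1 subr_eq0 => /eqP; right.
Qed.

Lemma truncpoly_mulX_eq0 k (p : {poly K}) : (k <= alpha)%N ->
  (pi 'X ^+ k * pi p == 0) = ('X^(alpha - k) %| p).
Proof.
move=> kal; rewrite -rmorphXn -rmorphM truncpoly_eq0 -{1}(subnKC kal) exprD.
by rewrite dvdp_mul2l // expf_neq0 ?polyX_eq0.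
Qed.

End TruncatedPolynomials.

Lemma truncpoly_chain_ring (F : finFieldType) alpha : (0 < alpha)%N ->
  finite_chain_ring (in_qpoly 'X^alpha 'X : truncpoly F alpha) alpha #|F|.
Proof.
move=> alpha_gt0; split.
- by apply/eqP; rewrite -rmorphXn truncpoly_eq0.
- rewrite -rmorphXn truncpoly_eq0 //; apply/negP => /dvdp_leq.
  by rewrite expf_neq0 ?polyX_eq0 // !size_polyXn prednK // ltnn => /(_ isT).
- move=> k kal; rewrite -card_npoly.
  (* Multiplication by X^(alpha - k) maps the q^k polynomials of size at most k bijectively onto the
     annihilator of t^k. *)
  pose f (y : {poly_k F}) : truncpoly F alpha :=
    in_qpoly 'X^alpha ('X^(alpha - k) * (y : {poly F})).
  have fE y : f y = 'X^(alpha - k) * (y : {poly F}) :> {poly F}.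
    apply: in_qpoly_small; rewrite mk_monic_truncpoly // size_polyXn ltnS.
    have [->|y0] := eqVneq (y : {poly F}) 0; first by rewrite mulr0 size_poly0.
    rewrite size_monicM ?monicXn // size_polyXn addSn /=.
    by apply: leq_trans (leq_add (leqnn _) (size_npoly y)) _; rewrite subnK.
  have f_inj : injective f.
    move=> y z /(congr1 (@polyn _ _)); rewrite !fE => /mulfI fyz.
    by apply/val_inj/fyz; rewrite expf_neq0 ?polyX_eq0.
  rewrite -(card_imset _ f_inj); apply: eq_card => x; rewrite inE.
  rewrite -{1}(truncpolyK x) truncpoly_mulX_eq0 //.
  apply/idP/imsetP => [/dvdpP[z xz]|[y _ ->]]; last first.
    by rewrite [X in _ %| X](fE y) dvdp_mulr.
  exists (npolyp k z) => //; apply: val_inj; rewrite [RHS](fE (npolyp k z)) npolypK.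
    by rewrite [LHS]xz mulrC.
  have [->|z0] := eqVneq z 0; first by rewrite size_poly0.
  have := size_mk_monic x.
  rewrite [X in (_ < size (polyseq X))%N]mk_monic_truncpoly // xz size_Mmonic ?monicXn //.
  rewrite !size_polyXn addnS ltnS => le_z.
  by rewrite -(leq_add2r (alpha - k)) subnKC.
(* Here x = z X^(alpha - k), and exactness of the level means that X does not divide z, so z is a
   unit. *)
move=> k x /andP[k0 kal] /eqP; rewrite -{1 2 3}(truncpolyK x).
rewrite truncpoly_mulX_eq0 // => /dvdpP[z ->].
rewrite truncpoly_mulX_eq0 //; last by apply: leq_trans kal; apply: leq_pred.
have -> : (alpha - k.-1 = (alpha - k).+1)%N by lia.
rewrite exprS dvdp_mul2r ?expf_neq0 ?polyX_eq0 // => zX.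
exists (in_qpoly 'X^alpha z); last by rewrite rmorphM rmorphXn.
apply: truncpoly_unit => //; apply: contra zX.
by rewrite -dvdp_XsubCl subr0.
Qed.

(** * Passage to the counting polynomial and its uniqueness *)

Lemma base_change_eq0 (F : finFieldType) alpha (x : truncpoly F alpha) :
  (0 < alpha)%N -> (base_change x == 0) = (x == 0).
Proof.
move=> alpha_gt0; rewrite truncpoly_eq0 // -(map_polyXn (to_alg_closure F)) dvdp_map.
by rewrite -truncpoly_eq0 // truncpolyK.
Qed.

Lemma abs_indecomposable_connecting (Q : quiver) (F : finFieldType) alpha
    (x : {ffun arrow Q -> truncpoly F alpha}) : (0 < alpha)%N ->
  `[< abs_indecomposable x >] = connecting [pred a | x a != 0].
Proof.
move=> alpha_gt0; apply/asboolP/idP => [/indecomposable_rank1|] conn.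
  rewrite -(eq_connecting (S := [pred a | base_change (x a) != 0])).
    by apply: conn; apply: truncpoly_idempotent.
  by move=> a; rewrite /= base_change_eq0.
apply/indecomposable_rank1; first exact: truncpoly_idempotent.
rewrite (eq_connecting (S' := [pred a | x a != 0])) // => a.
by rewrite /= base_change_eq0.
Qed.

Lemma rank1_iso_torus_orbit (Q : quiver) (F : finFieldType) alpha :
  @rank1_iso Q alpha F = @torus_orbit Q (truncpoly F alpha).
Proof.
apply/funext => x; apply/funext => y; apply: eq_existsb => g.
rewrite inE; congr andb; apply/forallP/eqP => [h|-> a]; last by rewrite ffunE.
by apply/ffunP => a; rewrite ffunE (eqP (h a)).
Qed.

Lemma num_abs_indecomposable_torus (Q : quiver) alpha (F : finFieldType)
    (t := in_qpoly 'X^alpha 'X : truncpoly F alpha) : (0 < alpha)%N ->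
  (num_abs_indecomposable Q alpha F * #|torus Q (truncpoly F alpha)|)%N =
  #|stable_pairs (Q := Q) t alpha (fun=> 0%N) (fun=> alpha)|.
Proof.
move=> alpha_gt0; have t_nilp := uniformizer_nilpotent (truncpoly_chain_ring F alpha_gt0).
rewrite card_stable_pairs_stabilizers // -card_orbits_stabilizers.
rewrite /num_abs_indecomposable rank1_iso_torus_orbit.
congr (#|pred_of_set (equivalence_partition _ _)| * _)%N.
by apply/setP => x; rewrite !inE abs_indecomposable_connecting.
Qed.

Lemma primes_unbounded n : exists s : seq nat, [/\ size s = n, uniq s & all prime s].
Proof.
elim: n => [|n [s [sn us ps]]]; first by exists [::].
have [p lt_p p_pr] := prime_above (\max_(i <- s) i).
exists (p :: s); rewrite /= sn p_pr us andbT; split=> //.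
by apply: contraL lt_p => ps'; rewrite -leqNgt leq_bigmax_seq.
Qed.

(** The prime fields alone suffice: A - B vanishes at every prime, hence at more points than a
    nonzero polynomial has roots. *)
Lemma counting_polynomial_unique (Q : quiver) alpha (A B : {poly int}) :
  is_counting_polynomial Q alpha A -> is_counting_polynomial Q alpha B -> A = B.
Proof.
move=> cA cB; apply/eqP; rewrite -subr_eq0; apply: contraT => AB0.
have [s [sn us ps]] := primes_unbounded (size (A - B)).
have := max_poly_roots (rs := [seq p%:Z | p <- s]) AB0.
rewrite size_map sn ltnn; apply.
  apply/allP => _ /mapP[p /(allP ps) p_pr ->].
  rewrite /root hornerD hornerN -{1 2}(card_Fp p_pr).
  by rewrite (cA 'F_p) (cB 'F_p) subrr.
by rewrite map_inj_uniq // => i j [].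
Qed.

Theorem theorem7 (Q : quiver) (alpha : nat) (halpha : (1 <= alpha)%N) :
  exists A : {poly int},
    unique (is_counting_polynomial Q alpha) A /\ forall i : nat, 0 <= A`_i.
Proof.
have [//|//|P [P0 PE]] :=
  @stable_pairs_polynomial Q alpha (fun=> 0%N) (fun=> alpha).
have countP : is_counting_polynomial Q alpha P.
  move=> F; have chainF := truncpoly_chain_ring F halpha.
  have := PE _ _ _ chainF; rewrite -num_abs_indecomposable_torus //.
  rewrite (congruence_torus0 _ (uniformizer_nilpotent chainF)) PoszM mulrC.
  (* The order of the torus cancels from both sides; it is nonzero because the torus contains the
     identity. *)
  move/mulfI => -> //; rewrite -lt0n; apply/card_gt0P; exists [ffun=> 1].
  by rewrite inE; apply/forallP => i; rewrite ffunE unitr1.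
exists P; split=> //; split=> // B; exact: counting_polynomial_unique.
Qed.
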